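(* Let $p$ be a prime and let $x\in\mathbb{T}=\mathbb{R}/\mathbb{Z}$ satisfy $m_p(x)>0$. Then $\dim_{\log}F_p(x)\ge1$.
   Context: $\mathbb{T}=\mathbb{R}/\mathbb{Z}$ is the circle with its usual metric. For real $t$, $\|t\|$ is the distance from $t$ to $\mathbb{Z}$; for a positive integer $q$ and $x\in\mathbb{T}$, $\|qx\|$ is well defined. $|\cdot|_p$ is the $p$-adic absolute value with $|p|_p=p^{-1}$. Put $m_p(x)=\liminf_{q\to\infty}q\,|q|_p\,\|qx\|$, with $q$ ranging over positive integers. Let $T_p:\mathbb{T}\to\mathbb{T}$, $T_p(y)=py \pmod 1$, and let $F_p(x)=\overline{\{T_p^k x:k\ge 0\}}$ (closure in $\mathbb{T}$). For a gauge function $h$ (continuous non-decreasing $h:[0,\infty)\to[0,\infty)$ with $h(0)=0$ and $h(r)>0$ for $r>0$), a subset $E$ of a metric space and $\delta>0$, $\mathcal{H}^h_\delta(E)=\inf\{\sum_i h(\operatorname{diam}U_i): E\subseteq\bigcup_i U_i,\ \operatorname{diam}U_i\le\delta\}$, the infimum being over countable covers, and $\mathcal{H}^h(E)=\lim_{\delta\to0}\mathcal{H}^h_\delta(E)$. For $s>0$, $h_s$ is the gauge $h_s(r)=1/(\log(1/r))^s$ for $0<r<e^{-1}$, $h_s(0)=0$, extended away from zero in any continuous non-decreasing way. The logarithmic Hausdorff dimension is $\dim_{\log}E=\inf\{s>0:\mathcal{H}^{h_s}(E)=0\}$ (with $\inf\emptyset=+\infty$). *)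

(* Defs.v *)
From HB Require Import structures.
From mathcomp Require Import all_boot all_order all_algebra.
From mathcomp Require Import all_classical all_reals all_analysis.

Set Implicit Arguments.
Unset Strict Implicit.
Unset Printing Implicit Defensive.

Import Order.TTheory GRing.Theory Num.Theory.
Import numFieldNormedType.Exports.

Local Open Scope classical_set_scope.
Local Open Scope ring_scope.
Local Open Scope quotient_scope.

Section dist_to_int.
Context {R : realType}.
Implicit Types t u : R.

Definition dist_int t : R := inf [set `|t - n%:~R| | n in [set: int]].

Lemma dist_int_le t (n : int) : dist_int t <= `|t - n%:~R|.
Proof.
apply: ge_inf; last by exists n.
by exists 0 => _ [m _ <-].
Qed.

Lemma dist_int_adherent t e : 0 < e -> exists n : int, `|t - n%:~R| < dist_int t + e.
Proof.
move=> e0; have [|_ [n _ <-] ?] := @inf_adherent _ [set `|t - n%:~R| | n in [set: int]] e e0.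
  split; first by exists `|t - 0%:~R|, 0.
  by exists 0 => _ [m _ <-].
by exists n.
Qed.

Lemma dist_int_ge0 t : 0 <= dist_int t.
Proof.
apply: lb_le_inf; first by exists `|t - 0%:~R|, 0.
by move=> _ [m _ <-].
Qed.

Lemma dist_int0 : dist_int 0 = 0.
Proof.
apply/eqP; rewrite eq_le dist_int_ge0 andbT.
by rewrite (le_trans (dist_int_le 0 0))// subrr normr0.
Qed.

Lemma dist_intN t : dist_int (- t) = dist_int t.
Proof.
suff H u : dist_int (- u) <= dist_int u.
  by apply/eqP; rewrite eq_le H -{1}(opprK t) H.
apply/ler_addgt0Pr => e /(dist_int_adherent u)[n /ltW]; apply: le_trans.
by rewrite (le_trans (dist_int_le _ (- n)))// mulrNz -opprD normrN.
Qed.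

Lemma dist_intD t u : dist_int (t + u) <= dist_int t + dist_int u.
Proof.
apply/ler_addgt0Pl => e e0.
have e20 : 0 < e / 2 by rewrite divr_gt0.
have [n nt] := dist_int_adherent t e20; have [m mu] := dist_int_adherent u e20.
rewrite (le_trans (dist_int_le _ (n + m)))// intrD opprD addrACA.
rewrite (le_trans (ler_normD _ _))// (le_trans (lerD (ltW nt) (ltW mu)))//.
by rewrite addrACA -splitr addrC.
Qed.

Lemma dist_int_eq0 t : dist_int t = 0 -> t \is a Num.int.
Proof.
move=> t0; have [|n] := @dist_int_adherent t 2^-1; first by rewrite invr_gt0.
rewrite t0 add0r => nt; apply/intrP; exists n; apply/eqP.
rewrite -subr_eq0 -normr_eq0; apply: contraT; rewrite -normr_gt0 normr_id => tn.
have [m] := dist_int_adherent t tn; rewrite t0 add0r => mt.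
have mn : m = n.
  apply/eqP; rewrite -subr_eq0 -absz_eq0 -leqn0 -ltnS -ltz_nat abszE.
  rewrite -(ltr_int R) intr_norm intrB.
  rewrite (_ : _ - _ = (t - n%:~R) - (t - m%:~R)); last first.
    by rewrite opprB [RHS]addrC addrA subrK.
  rewrite (le_lt_trans (ler_normB _ _))// [ltRHS](splitr 1) mul1r ltrD//.
  exact: lt_trans nt.
by move: mt; rewrite mn ltxx.
Qed.

Lemma dist_int_int t : t \is a Num.int -> dist_int t = 0.
Proof.
move=> /intrP[n ->]; apply/eqP; rewrite eq_le dist_int_ge0 andbT.
by rewrite (le_trans (dist_int_le _ n))// subrr normr0.
Qed.

Lemma dist_int_mod t u : t - u \is a Num.int -> dist_int t = dist_int u.
Proof.
suff H a b : a - b \is a Num.int -> dist_int a <= dist_int b.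
  move=> tu; apply/eqP; rewrite eq_le H//= H//.
  by rewrite -opprB rpredN.
move=> ab; rewrite -{1}(subrK b a) (le_trans (dist_intD _ _))//.
by rewrite dist_int_int// add0r.
Qed.

End dist_to_int.

Definition integers {R : realType} : pred R := [pred t | t \is a Num.int].

Fact integers_zmod_closed (R : realType) : zmod_closed (@integers R).
Proof. by split=> [|t u]; rewrite !inE ?rpred0//; exact: rpredB. Qed.

HB.instance Definition _ (R : realType) :=
  GRing.isZmodClosed.Build R (@integers R) (@integers_zmod_closed R).

(* Despite its name, [{ideal_quot I}] is, as a Z-module, the quotient by any
   additive subgroup [I]. *)
Local Notation circle_quot R :=
  {ideal_quot (GRing.ZmodClosed.clone R (@integers R) _)}.

Definition circle (R : realType) : Type := circle_quot R.

HB.instance Definition _ (R : realType) :=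
  GRing.Zmodule.copy (circle R) (circle_quot R).

Definition to_circle {R : realType} (t : R) : circle R :=
  \pi_(circle_quot R) t.

(* [circle_norm x] is ||t|| for any real t representing x; see
   [circle_norm_to_circle]. *)
Definition circle_norm {R : realType} (x : circle R) : R :=
  dist_int (repr (x : circle_quot R)).

Section circle_metric.
Context {R : realType}.
Implicit Types (t u : R) (x y z : circle R).

Lemma to_circle_surj x : exists t, to_circle t = x.
Proof. by exists (repr (x : circle_quot R)); exact: reprK. Qed.

Lemma to_circleD t u : to_circle (t + u) = to_circle t + to_circle u.
Proof. exact: Quotient.pi_add. Qed.

Lemma to_circleN t : to_circle (- t) = - to_circle t.
Proof. exact: Quotient.pi_opp. Qed.

Lemma to_circle_eq t u : (to_circle t == to_circle u) = (t - u \is a Num.int).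
Proof.
exact: (esym (Quotient.idealrBE (GRing.ZmodClosed.clone R (@integers R) _) t u)).
Qed.

Lemma circle_norm_to_circle t : circle_norm (to_circle t) = dist_int t.
Proof.
apply: dist_int_mod; rewrite -to_circle_eq; apply/eqP; exact: reprK.
Qed.

Definition circle_dist x y : R := circle_norm (x - y).

Lemma circle_distxx x : circle_dist x x = 0.
Proof.
have [t <-] := to_circle_surj x.
by rewrite /circle_dist -to_circleN -to_circleD circle_norm_to_circle subrr dist_int0.
Qed.

Lemma circle_dist_eq0 x y : circle_dist x y = 0 -> x = y.
Proof.
have [t <-] := to_circle_surj x; have [u <-] := to_circle_surj y.
rewrite /circle_dist -to_circleN -to_circleD circle_norm_to_circle.
by move=> /dist_int_eq0; rewrite -to_circle_eq => /eqP.
Qed.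

Lemma circle_dist_sym x y : circle_dist x y = circle_dist y x.
Proof.
have [t <-] := to_circle_surj x; have [u <-] := to_circle_surj y.
rewrite /circle_dist -!to_circleN -!to_circleD !circle_norm_to_circle.
by rewrite -dist_intN opprB.
Qed.

Lemma circle_dist_triangle y x z :
  circle_dist x z <= circle_dist x y + circle_dist y z.
Proof.
have [t <-] := to_circle_surj x; have [u <-] := to_circle_surj y.
have [v <-] := to_circle_surj z.
rewrite /circle_dist -!to_circleN -!to_circleD !circle_norm_to_circle.
by rewrite (le_trans _ (dist_intD _ _))// addrA subrK.
Qed.

End circle_metric.

HB.instance Definition _ (R : realType) := @isMetric.Build R (circle R)
  circle_dist circle_distxx circle_dist_eq0 circle_dist_sym
  circle_dist_triangle.

Section hausdorff_measure.
Context {R : realType}.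

(* Only the restriction of [h] to [0, +oo[ is relevant. *)
Record is_gauge (h : R -> R) : Prop := IsGauge {
  gauge_continuous : {within `[0, +oo[, continuous h} ;
  gauge_nondecreasing : {in `[0, +oo[ &, {homo h : r r' / r <= r'}} ;
  gauge0 : h 0 = 0 ;
  gauge_gt0 : forall r : R, 0 < r -> 0 < h r }.

Context {T : metricType R}.
Implicit Types (h : R -> R) (d : R) (U E : set T).

(* The maximum with 0 only serves to give the empty set diameter 0. *)
Definition diam U : \bar R :=
  maxe 0%E (ereal_sup [set (mdist x y)%:E | x in U & y in U]).

(* Finite covers are included, since [h (diam set0) = 0] for a gauge [h]. *)
Definition hausdorff_content h d E : \bar R :=
  ereal_inf [set (\sum_(0 <= i <oo) (h (fine (diam (U i))))%:E)%E |
    U in [set U : (set T)^nat |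
      E `<=` \bigcup_i U i /\ forall i, (diam (U i) <= d%:E)%E]].

Definition hausdorff_measure h E : \bar R :=
  lim (hausdorff_content h d E @[d --> 0^'+]).

End hausdorff_measure.

Section log_dimension.
Context {R : realType}.

Record is_log_gauge (s : R) (h : R -> R) : Prop := IsLogGauge {
  log_gauge_gauge : is_gauge h ;
  log_gaugeE : forall r : R, 0 < r < expR (- 1) -> h r = 1 / (ln (1 / r) `^ s) }.

(* The definition of h_s only constrains it near 0; a choice of gauges h_s is
   always possible. *)
Lemma log_gauge_exists (s : R) : 0 < s -> exists h, is_log_gauge s h.
Proof.
move=> s0; pose c : R := expR (- 1); have c0 : 0 < c := expR_gt0 _.
pose L (r : R) := - ln (Num.min r c).
have min_gt0 r : 0 < r -> 0 < Num.min r c by move=> r0; rewrite lt_min r0.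
have L_gt0 r : 0 < r -> 0 < L r.
  move=> r0; rewrite oppr_gt0 (@le_lt_trans _ _ (- 1))//.
  rewrite -[leRHS](@expRK R) ler_ln ?posrE ?min_gt0 ?expR_gt0//.
  by rewrite ge_min lexx orbT.
pose g r := expR (- (s * ln (L r))).
pose h r := if r <= 0 then 0 else g r.
have hE r : 0 < r -> h r = g r by rewrite ltNge /h => /negbTE ->.
have h00 : h 0 = 0 by rewrite /h lexx.
have gM r r' : 0 < r -> r <= r' -> g r <= g r'.
  move=> r0 rr'; have r'0 := lt_le_trans r0 rr'.
  rewrite ler_expR lerN2 ler_pM2l// ler_ln ?posrE ?L_gt0//.
  rewrite lerN2 ler_ln ?posrE ?min_gt0//.
  by rewrite le_min !ge_min rr' lexx orbT.
exists h; split; first split => //.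
- apply/continuous_within_itvcyP; split.
    move=> r; rewrite in_itv/= andbT => r0.
    have cg : {for r, continuous g}.
      rewrite /prop_for /g; apply: continuous_comp; last exact: continuous_expR.
      apply: cvgN; apply: cvgM; first exact: cvg_cst.
      apply: continuous_comp; last exact: continuous_ln (L_gt0 _ r0).
      apply: cvgN; apply: continuous_comp; last exact: continuous_ln (min_gt0 _ r0).
      by apply: continuous_min => //; exact: cvg_cst.
    have {cg} : g t @[t --> r] --> h r by rewrite hE.
    apply: cvg_trans; apply: near_eq_cvg; near=> t.
    by rewrite hE//; near: t; exact: lt_nbhsr.
  rewrite h00; apply/cvgrPdist_lt => e e0; near=> r.
  have r0 : 0 < r by near: r; exact: nbhs_right_gt.
  rewrite sub0r normrN hE// ger0_norm ?expR_ge0//.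
  rewrite -[ltRHS]lnK ?posrE// ltr_expR ltrNl.
  rewrite -ltr_pdivrMl// -ltr_expR lnK ?posrE ?L_gt0// ltrNr.
  rewrite -[ltRHS](@expRK R) ltr_ln ?posrE ?min_gt0 ?expR_gt0//.
  rewrite gt_min; apply/orP; left; near: r; apply: nbhs_right_lt.
  exact: expR_gt0.
- move=> r r'; rewrite !in_itv/= !andbT le_eqVlt => /predU1P[<- r'0 _|r0 r'0 rr'].
    by rewrite h00 /h; case: ifPn => // _; exact: expR_ge0.
  by rewrite !hE ?gM// (lt_le_trans r0).
- by move=> r r0; rewrite hE// expR_gt0.
- move=> r /andP[r0 rc]; rewrite hE// /g /L min_l ?ltW// !div1r.
  rewrite lnV ?posrE// /powR gt_eqF ?expRN//.
  by have := L_gt0 _ r0; rewrite /L min_l ?ltW.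
Unshelve. all: by end_near.
Qed.

(* The parameter [hs] is a choice, for each s > 0, of the gauge h_s. *)
Definition log_dim {T : metricType R} (hs : R -> R -> R) (E : set T) : \bar R :=
  ereal_inf [set s%:E | s in [set s : R | 0 < s /\
    hausdorff_measure (hs s) E = 0%E]].

End log_dimension.

(* The p-adic absolute value, on natural numbers. *)
Definition padic_abs {R : realType} (p n : nat) : R :=
  if n == 0%N then 0 else p%:R ^- logn p n.

Section times_p.
Context {R : realType} (p : nat).
Implicit Types x y : circle R.

Definition littlewood_inf x : \bar R :=
  limn_einf (fun n => let q := n.+1 in
    (q%:R * padic_abs p q * circle_norm (x *+ q))%:E).

Definition times_map y : circle R := y *+ p.

Definition orbit_closure x : set (circle R) :=
  closure [set iter k times_map x | k in [set: nat]].

End times_p.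

(* Main.v *)
From HB Require Import structures.
Require Import Defs.
From mathcomp Require Import all_boot all_order all_algebra.
From mathcomp Require Import all_classical all_reals all_analysis.
From mathcomp Require Import lra.

Import Order.TTheory GRing.Theory Num.Theory.
Import numFieldNormedType.Exports.

Local Open Scope classical_set_scope.
Local Open Scope ring_scope.

Set Implicit Arguments.
Unset Strict Implicit.

(** The orbit of [x] under multiplication by [p] recurs slowly at every scale,
    and a set that contains such an orbit cannot be covered too cheaply.

    Write [y_j] for [p^j x]. Applied to [q = p^j (p^d - 1)], for which
    [q |q|_p = p^d - 1], positivity of [m_p(x)] yields a constant [c > 0] such
    that, for all large [j] and all [d > 0],
      [c <= (p^d - 1) * dist (y_(j+d), y_j)]
    ([orbit_separation]). So if a set [V] has diameter less than [r], two visits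
    of the orbit to [V] at times [j] and [j + d] force [c < p^d r]: consecutive
    visits are at least [m] apart, where [m] is about [ln (c / r) / ln p].
    The visits to [V] then have density at most [1 / m].

    Suppose that sets [V_i] of diameters less than [r_i] cover the orbit closure.
    By compactness (after enlarging them slightly to open sets) finitely many
    suffice, and every time [j] is a visit to one of them; adding up the
    densities, [1 <= \sum_i 1 / m_i] ([separated_cover_sum_ge1]). For small
    [r] one has [m >= ln (1 / r) / (2 ln p)], and for [s <= 1] the gauge
    satisfies [h_s r = 1 / ln (1 / r) ^ s >= 1 / ln (1 / r)], hence
    [1 / m <= 2 ln p * h_s r] ([log_gauge_ge]). Every cover by
    small sets therefore has [h_s]-cost at least [1 / (2 ln p)], and the [h_s]-measure is positive for
    every [s < 1]. *)

(** * Separated sets of times *)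

(** Each [A i] has density at most [1 / m i], and densities of sets that cover
    the natural numbers add up to at least 1. *)
Lemma separated_cover_sum_ge1 (R : numFieldType) (n : nat) (A : 'I_n -> pred nat)
    (m : 'I_n -> nat) : (forall i, (0 < m i)%N) ->
  (forall i j k, A i j -> A i k -> (j < k)%N -> (m i <= k - j)%N) ->
  (forall k, exists i, A i k) ->
  1 <= \sum_i (m i)%:R^-1 :> R.
Proof.
(* Counting up to a common multiple of the [m i] makes the density bound exact,
   without boundary terms. *)
move=> m0 sep cov; pose N := (\prod_i m i)%N.
have N0 : (0 < N)%N by rewrite prodn_gt0.
have visits i : (#|[pred j : 'I_N | A i j]| * m i <= N)%N.
  have [q Nq] : exists q, N = (q * m i)%N.
    by apply/dvdnP; rewrite /N (bigD1 i)//= dvdn_mulr.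
  have q_lt (j : 'I_N) : (j %/ m i < q)%N by rewrite ltn_divLR// -Nq.
  (* Each of the [q] blocks of length [m i] contains at most one element. *)
  pose f (j : 'I_N) : 'I_q := Ordinal (q_lt j).
  rewrite [leqRHS]Nq leq_mul2r; apply/orP; right.
  rewrite -[leqRHS]card_ord -(@card_in_image _ _ f) ?max_card//.
  move=> j k; rewrite !inE => Aj Ak /(congr1 val)/= jk.
  apply/val_inj/eqP; apply: contraT; rewrite neq_ltn => jNk.
  wlog lt_jk : j k Aj Ak jk {jNk} / (j < k)%N => [H|].
    by case/orP: (jNk) => /H; apply => //; rewrite orbC.
  have := sep _ _ _ Aj Ak lt_jk.
  rewrite leqNgt ltn_subLR ?(ltnW lt_jk)// => /negP[].
  rewrite {1}(divn_eq k (m i)) {1}(divn_eq j (m i)) jk -addnA ltn_add2l.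
  by rewrite ltn_addl// ltn_mod.
have : (N <= \sum_i #|[pred j : 'I_N | A i j]|)%N.
  rewrite -[leqLHS]card_ord -sum1_card.
  under [leqRHS]eq_bigr do rewrite -sum1_card big_mkcond/=.
  rewrite exchange_big/=; apply: leq_sum => j _.
  have [i Aij] := cov j.
  by rewrite (bigD1 i)//= inE Aij.
rewrite -(ler_nat R) natr_sum => le_N.
have N0' : 0 < N%:R :> R by rewrite ltr0n.
rewrite -(ler_pM2l N0') mulr1 (le_trans le_N)// mulr_sumr ler_sum// => i _.
by rewrite ler_pdivlMr ?ltr0n// -natrM ler_nat.
Qed.

(** * Lower bounds for Hausdorff measures of compact sets *)

Section finite_covers.
Context {R : realType} {T : metricType R}.

Lemma diam_ge0 (U : set T) : (0 <= diam U)%E.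
Proof. by rewrite /diam le_max lexx. Qed.

Lemma mdist_le_diam (U : set T) (x y : T) : U x -> U y ->
  ((mdist x y)%:E <= diam U)%E.
Proof.
move=> Ux Uy; rewrite /diam le_max; apply/orP; right.
by apply: ereal_sup_ubound; exists x => //; exists y.
Qed.

(** Stated from the right, so as to include [r = 0], where a gauge is continuous
    only from that side. *)
Lemma gauge_continuous_right (h : R -> R) (r e : R) : is_gauge h -> 0 <= r ->
  0 < e -> exists2 t, 0 < t & forall u, r <= u < r + t -> h u <= h r + e.
Proof.
move=> [/continuous_within_itvcyP[hc h0] _ _ _] r0 e0.
have {hc h0} : h u @[u --> r^'+] --> h r.
  move: r0; rewrite le_eqVlt => /predU1P[<-//|r0].
  by apply: cvg_at_right_filter; apply: hc; rewrite in_itv/= r0.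
move=> /cvgrPdist_lt/(_ _ e0)[t /= t0 tP]; exists t => // u /andP[ru urt].
have [->|ur] := eqVneq u r; first by rewrite lerDl ltW.
have ru' : r < u by rewrite lt_neqAle eq_sym ur.
have : `|h r - h u| < e.
  by apply: tP => //=; rewrite ltr0_norm ?subr_lt0// opprB ltrBlDl.
by rewrite ltr_distlC => /andP[_ /ltW].
Qed.

(** A thin enough neighborhood of [U] costs at most [e] more than [U], because [h]
    is continuous from the right at [diam U]. The bound [r] is positive even if
    [U] is a single point: it is the size at which the gauge is evaluated, and
    [h] has an explicit formula only away from 0. *)
Lemma gauge_open_neighborhood (h : R -> R) (U : set T) (d e : R) :
  is_gauge h -> (diam U < d%:E)%E -> 0 < e ->
  exists V : set T, exists2 r : R, 0 < r < d & [/\ open V, U `<=` V,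
    forall x y, V x -> V y -> mdist x y < r & h r <= h (fine (diam U)) + e].
Proof.
move=> gh Ud e0.
have fU : diam U = (fine (diam U))%:E.
  by rewrite fineK// ge0_fin_numE ?diam_ge0// (lt_trans Ud) ?ltry.
set r0 := fine (diam U) in fU *.
have r00 : 0 <= r0 by rewrite fine_ge0 ?diam_ge0.
have r0d : r0 < d by rewrite -lte_fin -fU.
have [t t0 tP] := gauge_continuous_right gh r00 e0.
pose s := Num.min t (d - r0) / 2.
have s0 : 0 < s by rewrite divr_gt0// lt_min t0 subr_gt0.
have [st sd] : s < t /\ s < d - r0.
  have m0 : 0 < Num.min t (d - r0) by rewrite lt_min t0 subr_gt0.
  have : s < Num.min t (d - r0) by rewrite gtr_pMr// invf_lt1// ltr1n.
  by rewrite lt_min => /andP[].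
exists (\bigcup_(u in U) (ball u (s / 2))^°); exists (r0 + s).
  by rewrite ltr_wpDl//= -ltrBrDl.
split.
- by apply: bigcup_open => u _; exact: open_interior.
- by move=> u Uu; exists u => //; apply: nbhsx_ballx; rewrite divr_gt0.
- move=> y z [u Uu /interior_subset + [v Uv /interior_subset]].
  rewrite !ballEmdist/= => uy vz.
  rewrite (le_lt_trans (metric_triangle _ u _))// (splitr s) addrCA metric_sym.
  rewrite ltrD// (le_lt_trans (metric_triangle _ v _))// ler_ltD//.
  by rewrite -lee_fin -fU mdist_le_diam.
- by apply: tP; rewrite lerDl (ltW s0) ltrD2l.
Qed.

Lemma hausdorff_content_nonincreasing (h : R -> R) (E : set T) :
  {homo (fun d => hausdorff_content h d E) : d d' / d <= d' >-> (d' <= d)%E}.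
Proof.
move=> d d' dd'; apply: ereal_inf_le_tmp => _ [U [EU Ud] <-].
by exists U => //; split => // i; rewrite (le_trans (Ud i)) ?lee_fin.
Qed.

Lemma geometric_half_sum_le1 (n : nat) :
  \sum_(0 <= i < n) (2^-1 ^+ i.+1) <= 1 :> R.
Proof.
suff -> : \sum_(0 <= i < n) (2^-1 ^+ i.+1) = 1 - 2^-1 ^+ n :> R.
  by rewrite gerDl oppr_le0 exprn_ge0.
elim: n => [|n IH]; first by rewrite big_nil expr0 subrr.
rewrite big_nat_recr//= IH -addrA; congr (_ + _).
by rewrite exprS [X in - X + _](splitr) mulrC opprD subrK.
Qed.

(** Enlarging the [i]-th set of a countable cover to an open set at extra cost
    [e / 2^(i+1)] adds at most [e] in total; compactness then reduces lower
    bounds for the measure to the case of finite covers. The positive numbers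
    [r i] stand for the diameters. *)
Lemma hausdorff_measure_ge (h : R -> R) (E : set T) (k d : R) :
  is_gauge h -> cover_compact E -> 0 < d ->
  (forall (n : nat) (V : nat -> set T) (r : nat -> R),
    E `<=` \bigcup_(i < n) V i ->
    (forall i, 0 < r i < d) ->
    (forall i x y, V i x -> V i y -> mdist x y < r i) ->
    k <= \sum_(0 <= i < n) h (r i)) ->
  (k%:E <= hausdorff_measure h E)%E.
Proof.
move=> gh cE d0 finite_bound; apply: lime_ge.
  (* [lim] is meaningful only for a convergent filter: here by monotonicity. *)
  apply: nonincreasing_at_right_is_cvge; near=> z => a b _ _.
  exact: hausdorff_content_nonincreasing.
near=> d'; apply: le_ereal_inf_tmp => _ [U [EU Ud'] <-].
apply/lee_addgt0Pr => e e0.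
have d'd : d' < d by near: d'; exact: nbhs_right_lt.
have Ud i : (diam (U i) < d%:E)%E by rewrite (le_lt_trans (Ud' i)) ?lte_fin.
have e0' i : 0 < e * 2^-1 ^+ i.+1 by rewrite mulr_gt0// exprn_gt0.
have /choice[V /choice[r VrP]] : forall i, exists V : set T, exists r : R,
   [/\ 0 < r < d, open V, U i `<=` V,
    forall x y, V x -> V y -> mdist x y < r &
    h r <= h (fine (diam (U i))) + e * 2^-1 ^+ i.+1].
  move=> i; have [V [r ? [? ? ? ?]]] := gauge_open_neighborhood gh (Ud i) (e0' i).
  by exists V, r.
have [||D _ ED] := cE nat setT V.
- by move=> i _; have [] := VrP i.
- by move=> x /EU[i _ Ux]; exists i => //; have [_ _ + _ _] := VrP i; apply.
(* Replace the finite index set by an initial segment, which only adds sets. *)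
pose n := (\max_(i <- finmap.enum_fset D) i).+1.
have En : E `<=` \bigcup_(i < n) V i.
  move=> x /ED[i /= Di Vx]; exists i => //=.
  by rewrite ltnS; exact: (@leq_bigmax_seq _ _ xpredT id).
have := finite_bound n V r En.
move=> /(_ (fun i => let: And5 a _ _ _ _ := VrP i in a)).
move=> /(_ (fun i => let: And5 _ _ _ a _ := VrP i in a)).
have h_ge0 i : (0 <= (h (fine (diam (U i))))%:E)%E.
  rewrite lee_fin; case: gh => _ hm h0 _; rewrite -h0; apply: hm.
  - by rewrite in_itv/= lexx.
  - by rewrite in_itv/= andbT fine_ge0 ?diam_ge0.
  - by rewrite fine_ge0 ?diam_ge0.
move=> le_k; apply: (@le_trans _ _ ((\sum_(0 <= i < n) h (fine (diam (U i)))) + e)%:E).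
  rewrite lee_fin (le_trans le_k)//.
  apply: (@le_trans _ _ (\sum_(0 <= i < n)
      (h (fine (diam (U i))) + e * 2^-1 ^+ i.+1))).
    by apply: ler_sum => i _; have [] := VrP i.
  rewrite big_split/= lerD2l -mulr_sumr ger_pMr// geometric_half_sum_le1//.
rewrite EFinD leeD2r// -sumEFin.
by apply: nneseries_lim_ge => i _ _; exact: h_ge0.
Unshelve. all: by end_near.
Qed.

End finite_covers.

(** * Compactness of the circle *)

Section circle_compactness.
Context {R : realType}.

Lemma mdist_to_circle_le (t u : R) :
  mdist (to_circle t) (to_circle u) <= `|t - u|.
Proof.
rewrite /mdist/= /circle_dist -to_circleN -to_circleD circle_norm_to_circle.
by have := dist_int_le (t - u) 0; rewrite subr0.
Qed.

Lemma continuous_to_circle : continuous (@to_circle R).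
Proof.
move=> t; apply/cvg_ballP => e e0.
apply: filterS (@cvgr_dist_lt _ _ _ _ _ id t (@cvg_id _ _) _ e0) => u tu.
by rewrite ballEmdist/=; apply: le_lt_trans tu; exact: mdist_to_circle_le.
Qed.

(* [compact_cover], used below, is a statement about pointed spaces. *)
HB.instance Definition _ := isPointed.Build (circle R) 0.

Lemma compact_circle : compact [set: circle R].
Proof.
have <- : @to_circle R @` `[0, 1] = [set: circle R].
  apply/seteqP; split => // y _; have [t <-] := to_circle_surj y.
  exists (t - (Num.floor t)%:~R).
    rewrite /= in_itv/= subr_ge0 ge_floor/= lerBlDl.
    by rewrite ltW// -[ltRHS]intrD1 floorD1_gt.
  by apply/eqP; rewrite to_circle_eq addrAC subrr add0r rpredN intr_int.
apply: continuous_compact; last exact: segment_compact.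
by apply: continuous_subspaceT; exact: continuous_to_circle.
Qed.

Lemma cover_compact_orbit_closure (p : nat) (x : circle R) :
  cover_compact (orbit_closure p x).
Proof.
rewrite -compact_cover.
by apply: (subclosed_compact _ compact_circle) => //; exact: closed_closure.
Qed.

End circle_compactness.

(** * Slow recurrence of the orbit *)

Section recurrence.
Context {R : realType} (p : nat).
Implicit Types x : circle R.

Lemma iter_times_map k x : iter k (times_map p) x = x *+ (p ^ k).
Proof. by elim: k => //= k ->; rewrite /times_map -mulrnA -expnSr. Qed.

Lemma orbit_closure_iter k x : orbit_closure p x (x *+ (p ^ k)).
Proof. by apply: subset_closure; exists k => //; rewrite iter_times_map. Qed.

(** A positive lower limit only bounds the terms from some rank on; this is
    enough, as the orbit may be started late. *)
Lemma littlewood_inf_gt0 x : (0 < littlewood_inf p x)%E ->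
  exists2 c : R, 0 < c & exists N, forall q, (N < q)%N ->
    c <= q%:R * padic_abs p q * circle_norm (x *+ q).
Proof.
rewrite /littlewood_inf; set u : (\bar R)^nat := fun n => _.
rewrite limn_einf_lim (cvg_lim _ (@cvg_einfs_sup R u))//.
move=> /ereal_sup_gt[_ [N _ <-]]; rewrite /einfs/= => inf0.
have inf_le n : (N <= n)%N -> (ereal_inf (sdrop u N) <= u n)%E.
  by move=> Nn; apply: ereal_inf_lbound; exists n.
have inf_fin : ereal_inf (sdrop u N) \is a fin_num.
  by rewrite gt0_fin_numE// (le_lt_trans (inf_le N _)) ?ltry.
exists (fine (ereal_inf (sdrop u N))).
  by rewrite -lte_fin fineK.
exists N => -[//|q] Nq; rewrite -lee_fin fineK//.
exact: inf_le.
Qed.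

(** The case [q = p^j (p^d - 1)] of the bound: the factor [p^j] of [q] is
    cancelled by [|q|_p], so that the constant does not degrade along the
    orbit. *)
Lemma orbit_separation (hp : prime p) x (c : R) (N j d : nat) :
  (forall q, (N < q)%N -> c <= q%:R * padic_abs p q * circle_norm (x *+ q)) ->
  (N < p ^ j)%N -> (0 < d)%N ->
  c <= p%:R ^+ d * mdist (x *+ (p ^ (j + d))) (x *+ (p ^ j)).
Proof.
move=> hc Nj d0; have p1 := prime_gt1 hp; have p0 := prime_gt0 hp.
have pd1 : (0 < p ^ d - 1)%N by rewrite subn_gt0 -[1%N](expn0 p) ltn_exp2l.
have qE : (p ^ (j + d) - p ^ j = p ^ j * (p ^ d - 1))%N.
  by rewrite expnD mulnBr muln1.
have logq : logn p (p ^ j * (p ^ d - 1)) = j.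
  rewrite lognM ?expn_gt0 ?p0// pfactorK// logn_coprime ?addn0//.
  rewrite prime_coprime//; apply/negP => /(dvdn_addr 1).
  by rewrite subnK ?expn_gt0 ?p0// dvdn_exp// dvdn1 gtn_eqF.
have Nq : (N < p ^ j * (p ^ d - 1))%N by rewrite (leq_trans Nj)// leq_pmulr.
have := hc _ Nq; rewrite /padic_abs gtn_eqF ?(leq_ltn_trans _ Nq)// logq.
rewrite natrM natrX (mulrAC _ _ (_ ^- _)) divff ?expf_neq0 ?pnatr_eq0 ?gtn_eqF// mul1r.
rewrite -qE (mulrnBr x) ?leq_pexp2l ?leq_addr// => /le_trans; apply.
apply: ler_wpM2r; first exact: dist_int_ge0.
by rewrite -natrX ler_nat leq_subr.
Qed.

End recurrence.

(** * Logarithmic gauges against return times *)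

(** Here [m] is the least integer greater than [D = ln (c / r) / ln p], so that
    [p^d r <= c] for [d < m]. The condition [r < c^2] makes
    [ln (c / r) >= ln (1 / r) / 2], which absorbs the constant [c]; the condition
    [r < e^-1] makes [ln (1 / r) >= 1], whose [s]-th power then grows with
    [s]. *)
Lemma log_gauge_ge {R : realType} (p : nat) (s c r : R) (h : R -> R) :
  (1 < p)%N -> s <= 1 -> is_log_gauge s h -> 0 < c ->
  0 < r -> r < c ^+ 2 -> r < expR (-1) ->
  exists2 m : nat, (0 < m)%N &
    (forall d, (d < m)%N -> p%:R ^+ d * r <= c) /\
    (2 * ln p%:R)^-1 * m%:R^-1 <= h r.
Proof.
move=> p1 s1 [_ hE] c0 r0 rc re.
have lnp : 0 < ln p%:R :> R by rewrite ln_gt0// ltr1n.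
set L := ln (1 / r).
have L1 : 1 <= L.
  by rewrite /L div1r lnV ?posrE// lerNr -[leRHS]expRK ler_ln ?posrE ?expR_gt0// ltW.
have L0 : 0 < L by rewrite (lt_le_trans ltr01).
pose D := ln (c / r) / ln p%:R.
have LD : L <= 2 * ln p%:R * D.
  have cr : ln (c / r) = ln c + L.
    by rewrite /L div1r lnM ?posrE ?invr_gt0.
  have c2L : - L <= 2 * ln c.
    by rewrite mulr_natl -lnXn// /L div1r lnV ?posrE// opprK ler_ln ?posrE ?exprn_gt0// ltW.
  rewrite /D mulrA mulrAC mulfK ?gt_eqF// cr; lra.
have D0 : 0 < D.
  by rewrite -(pmulr_rgt0 D (mulr_gt0 (ltr0n R 2) lnp)) (lt_le_trans L0).
exists (Num.truncn D).+1 => //; split=> [d|].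
  rewrite ltnS => dD; rewrite -ler_pdivlMr//.
  have : d%:R <= D.
    by apply: (@le_trans _ _ (Num.truncn D)%:R); rewrite ?ler_nat// truncn_le ltW.
  rewrite (ler_pdivlMr d%:R _ lnp) mulr_natl -lnXn ?ltr0n ?(ltnW p1)//.
  by rewrite ler_ln ?posrE ?divr_gt0// exprn_gt0// ltr0n ltnW.
have hrE : h r = (L `^ s)^-1 by rewrite hE ?r0// div1r.
apply: (@le_trans _ _ L^-1).
  rewrite -invfM lef_pV2 ?posrE ?mulr_gt0 ?ltr0n// (le_trans LD)//.
  by rewrite ler_pM2l ?mulr_gt0// ltW// truncnS_gt.
rewrite hrE lef_pV2 ?posrE ?powR_gt0//.
by rewrite -[leRHS]powRr1 ?(ltW L0)// ler_powR.
Qed.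

Unset Implicit Arguments.

(** * Logarithmic dimension of the orbit closure *)

Theorem corollary2p4 (R : realType) (p : nat) (hp : prime p)
    (hs : R -> R -> R) (hhs : forall s : R, 0 < s -> is_log_gauge s (hs s))
    (x : circle R) (hx : (0 < littlewood_inf p x)%E) :
  (1 <= log_dim hs (orbit_closure p x))%E.
Proof.
have p1 := prime_gt1 hp.
have [c c0 [N hc]] := littlewood_inf_gt0 hx.
apply: le_ereal_inf_tmp => _ [s [s0 measure0] <-].
rewrite lee_fin leNgt; apply/negP => s1.
have lnp : 0 < ln p%:R :> R by rewrite ln_gt0// ltr1n.
pose k : R := (2 * ln p%:R)^-1.
have k0 : 0 < k by rewrite invr_gt0 mulr_gt0.
suff : (k%:E <= hausdorff_measure (hs s) (orbit_closure p x))%E.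
  by rewrite measure0 lee_fin leNgt k0.
apply: (@hausdorff_measure_ge _ _ _ _ _ (Num.min (c ^+ 2) (expR (-1)))).
- exact: log_gauge_gauge (hhs _ s0).
- exact: cover_compact_orbit_closure.
- by rewrite lt_min exprn_gt0// expR_gt0.
move=> n V r EV r_small diamV.
have /choice[m mP] i : exists m : nat, [/\ (0 < m)%N,
    forall d, (d < m)%N -> p%:R ^+ d * r i <= c & k * m%:R^-1 <= hs s (r i)].
  have /andP[ri0] := r_small i; rewrite lt_min => /andP[ric rie].
  have [m m0 [pm mh]] := log_gauge_ge p1 (ltW s1) (hhs _ s0) c0 ri0 ric rie.
  by exists m.
(* The times of visit to [V i], counted from time [N], as [p^N > N] puts the
   orbit in the range of validity of the bound [hc]. *)
pose A (i : 'I_n) : pred nat := fun j => `[< V i (x *+ (p ^ (N + j))) >].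
have : 1 <= \sum_(i < n) (m i)%:R^-1 :> R.
  apply: (@separated_cover_sum_ge1 _ _ A).
  - by move=> i; have [] := mP i.
  - move=> i j l /asboolP Vj /asboolP Vl jl; rewrite leqNgt; apply/negP => lt_m.
    have [_ /(_ _ lt_m) rc _] := mP i.
    have Nj : (N < p ^ (N + j))%N.
      by rewrite (leq_trans (ltn_expl N p1))// leq_pexp2l ?leq_addr// ltnW.
    have := orbit_separation hp hc Nj (d := (l - j)%N).
    rewrite subn_gt0 => /(_ jl).
    rewrite -addnA subnKC ?(ltnW jl)// leNgt => /negP; apply.
    apply: lt_le_trans rc; rewrite ltr_pM2l ?exprn_gt0 ?ltr0n ?(ltnW p1)//.
    exact: diamV.
  - move=> j; have [i /= ltin Vi] := EV _ (@orbit_closure_iter _ p (N + j) x).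
    by exists (Ordinal ltin); apply/asboolP.
rewrite -(ler_pM2l k0) mulr1 => /le_trans; apply.
rewrite mulr_sumr big_mkord; apply: ler_sum => i _.
by have [] := mP i.
Qed.
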